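(* Let $\{f_n\}$ be a countable complete and minimal family in a separable Hilbert space $\mathcal{H}$, and let $\{r_n\}$ be its unique biorthogonal family in $\mathcal{H}$. If positive constants $\{c_n\}$ satisfy $\sum_n \|r_n\|^2/c_n^2<\infty$, then the family $\{r_n/c_n\}$ is a Bessel sequence in $\mathcal{H}$, and the family $\{c_n f_n\}$ is a complete Riesz-Fischer sequence in $\mathcal{H}$, hence a lower semi frame for $\mathcal{H}$.
   Context: Let $\{f_n\}$ be a countable family in a separable Hilbert space $\mathcal{H}$ with inner product $\langle\cdot,\cdot\rangle$ and norm $\|\cdot\|$. The family is complete if its closed linear span is $\mathcal{H}$. It is minimal if each $f_n$ lies outside the closed linear span of the remaining elements. A biorthogonal family to $\{f_n\}$ is a family $\{g_n\}$ in $\mathcal{H}$, with the same index set, such that $\langle f_n,g_m\rangle=\delta_{n,m}$ for all $n,m$; it exists if and only if $\{f_n\}$ is minimal, and it is unique if $\{f_n\}$ is complete and minimal. The family $\{f_n\}$ is a Bessel sequence if there is $D>0$ with $\sum_n|\langle f,f_n\rangle|^2\le D\|f\|^2$ for all $f\in\mathcal{H}$. It is a lower semi frame for $\mathcal{H}$ if there is $C>0$ with $C\|f\|^2\le\sum_n|\langle f,f_n\rangle|^2$ for all $f\in\mathcal{H}$ (the sum may equal $+\infty$). It is a Riesz-Fischer sequence if for every $\{a_n\}\in\ell^2$ there is $f\in\mathcal{H}$ with $\langle f,f_n\rangle=a_n$ for all $n$. *)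

(* Defs.v *)
From HB Require Import structures.
From mathcomp Require Import all_boot all_order all_algebra.
From mathcomp Require Import all_classical all_reals all_analysis.
From mathcomp Require Import complex.

Set Implicit Arguments.
Unset Strict Implicit.
Unset Printing Implicit Defensive.

Import Order.TTheory GRing.Theory Num.Theory.
Import numFieldNormedType.Exports.

Local Open Scope classical_set_scope.
Local Open Scope ring_scope.

(* A Hilbert space may be real or complex: its scalar field is [scalars R k],
   that is, [R] or [R[i]]. *)
Variant scalar_kind := RealScalars | ComplexScalars.

Definition scalars (R : realType) (k : scalar_kind) : numFieldType :=
  match k with
  | RealScalars => R : numFieldType
  | ComplexScalars => R[i] : numFieldType
  end.

Definition conjs (R : realType) (k : scalar_kind) :
    scalars R k -> scalars R k :=
  match k with
  | RealScalars => fun x : R => x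
  | ComplexScalars => fun z : R[i] => conjc z
  end.

Definition of_real (R : realType) (k : scalar_kind) : R -> scalars R k :=
  match k with
  | RealScalars => fun x : R => x
  | ComplexScalars => fun x : R => Complex x 0
  end.
Arguments of_real {R} k _.

Definition re_part (R : realType) (k : scalar_kind) : scalars R k -> R :=
  match k with
  | RealScalars => fun x : R => x
  | ComplexScalars => fun z : R[i] => complex.Re z
  end.
Arguments re_part {R} k _.

(* The norm [`|x|] of MathComp takes its values in the scalar field, where it
   is real and nonnegative; [rnorm x] is the same number, as an element of [R].
   It applies both to vectors and to scalars. *)
Definition rnorm (R : realType) (k : scalar_kind)
    (V : normedZmodType (scalars R k)) (x : V) : R :=
  re_part k `|x|.

Definition separable (T : topologicalType) : Prop :=
  exists A : set T, countable A /\ dense A.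

Section Families.
Context (R : realType) (k : scalar_kind).
Context (H : completeNormedModType (scalars R k)).
Context (I : countType).

Definition lin_span (f : I -> H) (J : set I) : set H :=
  [set x | exists (s : seq I) (a : I -> scalars R k),
     [set` s] `<=` J /\ x = \sum_(i <- s) a i *: f i].

Definition complete_family (f : I -> H) : Prop :=
  closure (lin_span f [set: I]) = [set: H].

Definition minimal_family (f : I -> H) : Prop :=
  forall i, ~ closure (lin_span f (~` [set i])) (f i).

(* A form in [{dot H for @conjs R k}] is linear in its first argument and
   conjugate-linear in the second one. *)
Context (ip : {dot H for @conjs R k}).

Definition biorthogonal (f g : I -> H) : Prop :=
  forall n m, ip (f n) (g m) = (n == m)%:R.

(* [\esum] is the supremum in [\bar R] of the finite partial sums, so that the
   sum may be [+oo]. *)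
Definition bessel_sequence (f : I -> H) : Prop :=
  exists2 D : R, 0 < D & forall h : H,
    (\esum_(i in [set: I]) (rnorm (ip h (f i)) ^+ 2)%:E
       <= (D * rnorm h ^+ 2)%:E)%E.

Definition lower_semi_frame (f : I -> H) : Prop :=
  exists2 C : R, 0 < C & forall h : H,
    ((C * rnorm h ^+ 2)%:E
       <= \esum_(i in [set: I]) (rnorm (ip h (f i)) ^+ 2)%:E)%E.

Definition riesz_fischer_sequence (f : I -> H) : Prop :=
  forall a : I -> scalars R k,
    (\esum_(i in [set: I]) (rnorm (a i) ^+ 2)%:E < +oo)%E ->
    exists h : H, forall i, ip h (f i) = a i.

End Families.

(* Main.v *)
Require Import Defs.
From HB Require Import structures.
From mathcomp Require Import all_boot all_order all_algebra.
From mathcomp Require Import all_classical all_reals all_analysis.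
From mathcomp Require Import complex ring lra.

Set Implicit Arguments.
Unset Strict Implicit.
Unset Printing Implicit Defensive.

Import Order.TTheory GRing.Theory Num.Theory.
Import numFieldNormedType.Exports.

Local Open Scope classical_set_scope.
Local Open Scope ring_scope.

(** Put [g n = c n f n] and [q n = r n / c n]. The two families are again
    biorthogonal, [g] spans the same subspace as [f] and is therefore complete,
    and the hypothesis says that the sum of the [|q n|^2] is some finite [B].

    - Bessel bound: [|<h, q n>|^2 <= |h|^2 |q n|^2] by Cauchy-Schwarz
      ([ler_rnorm_ip]), and summing over [n] gives the constant [B].
    - Riesz-Fischer property: if [a] is square summable, then
      [x = \sum_n a n q n] converges absolutely, since
      [2 |a n| |q n| <= t |a n|^2 + |q n|^2 / t] for each [t > 0].
      Biorthogonality gives [<x, g n> = a n], and the same inequality bounds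
      [|x|] by [(t A + B / t) / 2], where [A] is the sum of the [|a n|^2]
      ([interpolation]).
    - Lower bound: let [a n = <h, g n>], with a finite sum of squares [A]. The
      interpolating [x] has the same coefficients as [h], so [x = h] because
      [g] is complete ([complete_ortho]). Hence [|h| <= (t A + B / t) / 2] for
      every [t > 0], and [t = B / |h|] turns this into [|h|^2 <= A B].

    Frame constants must be positive, while [B = 0] when the index set is
    empty; [B + 1] takes the place of [B] in the two frame bounds.

    The norm of a space over [scalars R k] takes its values in [scalars R k];
    all estimates are carried out in [R], through [rnorm], which makes them
    the same for real and complex scalars. *)

(** * Real numbers inside the scalar field *)

Section Scalars.
Context (R : realType) (k : scalar_kind).
Implicit Types (x y : R) (z : scalars R k).

Lemma of_realD x y : of_real k (x + y) = of_real k x + of_real k y.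
Proof. by case: k => //=; exact: (rmorphD (real_complex R)). Qed.

Lemma of_realM x y : of_real k (x * y) = of_real k x * of_real k y.
Proof. by case: k => //=; exact: (rmorphM (real_complex R)). Qed.

Lemma of_real0 : of_real k (0 : R) = 0.
Proof. by case: k. Qed.

Lemma ler_of_real x y : (of_real k x <= of_real k y) = (x <= y).
Proof. by case: k => //=; exact: lecR. Qed.

Lemma ltr_of_real x y : (of_real k x < of_real k y) = (x < y).
Proof. by case: k => //=; exact: ltcR. Qed.

Lemma of_realK x : re_part k (of_real k x) = x.
Proof. by case: k. Qed.

Lemma re_partK z : 0 <= z -> of_real k (re_part k z) = z.
Proof.
by case: k z => //= -[a b]; rewrite lecE /= => /andP[/eqP -> _].
Qed.

Lemma mul_conjs z : z * conjs z = `|z| ^+ 2.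
Proof.
case: k z => [z | z] /=; first by rewrite real_normK ?num_real// expr2.
by rewrite normCK.
Qed.

Lemma conjs_nat (n : nat) : conjs (n%:R : scalars R k) = n%:R.
Proof. by case: k => //=; exact: (rmorph_nat (@conjc R)). Qed.

Lemma conjs_of_real x : conjs (of_real k x) = of_real k x.
Proof. by case: k => //=; exact: conjc_real. Qed.

Lemma of_realV x : of_real k x^-1 = (of_real k x)^-1.
Proof. by case: k => //=; exact: (fmorphV (real_complex R)). Qed.

End Scalars.

(** * The real-valued norm *)

Section RealNorm.
Context (R : realType) (k : scalar_kind) (V : normedZmodType (scalars R k)).
Implicit Types (u v : V).

Lemma of_rnorm u : of_real k (rnorm u) = `|u|.
Proof. exact: re_partK. Qed.

Lemma rnorm_ge0 u : 0 <= rnorm u.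
Proof. by rewrite -(ler_of_real k) of_rnorm of_real0. Qed.

Lemma rnorm0 : rnorm (0 : V) = 0.
Proof. by rewrite /rnorm normr0 -(of_real0 R k) of_realK. Qed.

Lemma rnorm_eq0 u : (rnorm u == 0) = (u == 0).
Proof.
apply/eqP/eqP => [u0|->]; last exact: rnorm0.
by apply/eqP; rewrite -normr_eq0 -of_rnorm u0 of_real0.
Qed.

Lemma ler_rnormD u v : rnorm (u + v) <= rnorm u + rnorm v.
Proof. by rewrite -(ler_of_real k) of_realD !of_rnorm ler_normD. Qed.

Lemma ler_rnorm_sum (J : Type) (s : seq J) (P : pred J) (F : J -> V) :
  rnorm (\sum_(j <- s | P j) F j) <= \sum_(j <- s | P j) rnorm (F j).
Proof.
elim/big_ind2 : _ => // [|x1 x2 y1 y2 le1 le2]; first by rewrite rnorm0.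
exact: le_trans (ler_rnormD _ _) (lerD le1 le2).
Qed.

End RealNorm.

Lemma rnorm_of_real (R : realType) k (x : R) :
  0 <= x -> rnorm (of_real k x) = x.
Proof.
by move=> x0; rewrite /rnorm ger0_norm ?of_realK// -(of_real0 R k) ler_of_real.
Qed.

Lemma rnormZ (R : realType) k (V : normedModType (scalars R k)) a (u : V) :
  rnorm (a *: u) = rnorm a * rnorm u.
Proof.
by rewrite -(of_realK k (rnorm a * rnorm u)) of_realM !of_rnorm -normrZ.
Qed.

(** * Extended sums and finite partial sums *)

Section SumBounds.
Context (R : realType) (I : choiceType).
Implicit Types (F : I -> R) (s : seq I).

Lemma sum_le_esum F s : uniq s ->
  ((\sum_(i <- s) F i)%:E <= \esum_(i in [set: I]) (F i)%:E)%E.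
Proof.
move=> us; apply: esum_ge; exists [set` s]; first by split.
by rewrite -fsbig_seq// sumEFin.
Qed.

Lemma esum_le F (B : R) :
  (forall s, uniq s -> \sum_(i <- s) F i <= B) ->
  (\esum_(i in [set: I]) (F i)%:E <= B%:E)%E.
Proof.
move=> FB; apply: ge_ereal_sup => _ [A [finA _] <-].
by rewrite fsbig_finite//= sumEFin lee_fin FB.
Qed.

(** Converts a summability hypothesis into a bound in [R] on the finite partial
    sums, the form in which all later estimates consume it. *)
Lemma esum_lty_bound F : (forall i, 0 <= F i) ->
  (\esum_(i in [set: I]) (F i)%:E < +oo)%E ->
  exists2 B : R, \esum_(i in [set: I]) (F i)%:E = B%:E &
    forall s, uniq s -> \sum_(i <- s) F i <= B.
Proof.
move=> F0 Foo; have : (0 <= \esum_(i in [set: I]) (F i)%:E)%E.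
  by apply: esum_ge0 => i _; rewrite lee_fin.
case E : (\esum_(i in [set: I]) (F i)%:E)%E Foo => [B| |]// _ _.
by exists B => // s us; rewrite -lee_fin -E; exact: sum_le_esum.
Qed.

End SumBounds.

(** * Inner products *)

Section InnerProduct.
Context (R : realType) (k : scalar_kind) (H : normedModType (scalars R k)).
Context (ip : {dot H for @conjs R k}).
Implicit Types (u v w : H) (a : scalars R k).

Lemma ipZr a u v : ip u (a *: v) = conjs a * ip u v.
Proof. exact: linearZr_LR. Qed.

Lemma ipZl a u v : ip (a *: u) v = a * ip u v.
Proof. exact: linearZl_LR. Qed.

Lemma ipC u v : ip u v = conjs (ip v u).
Proof. by rewrite (@hermitian_subproof _ _ _ _ ip) expr0 mul1r. Qed.

Lemma ip0r u : ip u 0 = 0.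
Proof. exact: linear0r. Qed.

Lemma ipBl u v w : ip (u - v) w = ip u w - ip v w.
Proof. exact: linearBl. Qed.

Lemma ipBr u v w : ip w (u - v) = ip w u - ip w v.
Proof. exact: linearBr. Qed.

Lemma ipsumr J (s : seq J) (F : J -> H) w :
  ip w (\sum_(j <- s) F j) = \sum_(j <- s) ip w (F j).
Proof. exact: linear_sumr. Qed.

Lemma ipsuml J (s : seq J) (F : J -> H) w :
  ip (\sum_(j <- s) F j) w = \sum_(j <- s) ip (F j) w.
Proof. exact: linear_sumlz. Qed.

Hypothesis norm_ip : forall x : H, `|x| ^+ 2 = ip x x.

(** The Cauchy-Schwarz inequality: expand [0 <= <w, w>] for the component [w]
    of [u] orthogonal to [v]. *)
Lemma ler_rnorm_ip u v : rnorm (ip u v) <= rnorm u * rnorm v.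
Proof.
rewrite -(ler_of_real k) of_realM !of_rnorm.
have [->|v0] := eqVneq v 0; first by rewrite ip0r !normr0 mulr0.
have vv0 : 0 < ip v v by rewrite -norm_ip exprn_gt0// normr_gt0.
(* Scaling the orthogonal component by [|v|^2] avoids a division. *)
pose w := ip v v *: u - ip u v *: v.
have wv : ip w v = 0 by rewrite ipBl !ipZl mulrC subrr.
have ww : ip w w = ip v v * (ip v v * ip u u - `|ip u v| ^+ 2).
  rewrite {2}/w ipBr !ipZr wv mulr0 subr0 -ipC ipBl !ipZl -mul_conjs.
  by rewrite (ipC v u).
have : 0 <= ip w w by rewrite -norm_ip exprn_ge0.
rewrite ww pmulr_rge0// subr_ge0 -!norm_ip -exprMn mulrC.
by rewrite ler_pXn2r// ?nnegrE ?mulr_ge0.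
Qed.

End InnerProduct.

(** * Absolutely summable families *)

(** The partial sums over the first [n] elements of [I] in the enumeration by
    [pickle] form a Cauchy sequence, because they are controlled by the bounded
    nondecreasing sequence of the partial sums of the norms. The conclusion speaks
    of finite subfamilies containing a given index, which frees its users from
    the enumeration. *)
Lemma absolutely_summable (R : realType) (k : scalar_kind)
    (H : completeNormedModType (scalars R k)) (I : countType) (w : I -> H)
    (M : R) :
  (forall s : seq I, uniq s -> \sum_(i <- s) rnorm (w i) <= M) ->
  exists2 x, rnorm x <= M &
    forall m e, 0 < e -> exists s : seq I,
      [/\ uniq s, m \in s & rnorm (x - \sum_(i <- s) w i) < e].
Proof.
move=> wM.
pose s n := pmap (@pickle_inv I) (iota 0 n).
pose S n := \sum_(i <- s n) w i; pose T n := \sum_(i <- s n) rnorm (w i).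
have us n : uniq (s n) by apply: (pmap_uniq (@pickle_invK I)); exact: iota_uniq.
have TM n : T n <= M by exact: wM.
have ST m n : (m <= n)%N -> rnorm (S m - S n) <= T n - T m.
  move=> mn; rewrite /S /T /s -(subnKC mn) iotaD pmap_cat !big_cat/=.
  rewrite opprD addrA subrr sub0r [leRHS]addrAC subrr add0r.
  by rewrite /rnorm normrN; exact: ler_rnorm_sum.
have supT : has_sup (range T).
  by split; [exists (T 0); exists 0%N|exists M => _ [n _ <-]].
have TL n : T n <= sup (range T) by apply: ub_le_sup; [case: supT|exists n].
have : cauchy (S n @[n --> \oo]).
  apply: cauchy_exP => e e0.
  have re0 : 0 < re_part k e.
    by rewrite -(ltr_of_real k) of_real0 re_partK ?ltW.
  have [_ [N _ <-] LN] := sup_adherent re0 supT.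
  exists (S N), N => //= n /= Nn.
  rewrite -ball_normE/= -(re_partK (ltW e0)) -of_rnorm ltr_of_real.
  apply: (le_lt_trans (ST _ _ Nn)).
  apply: (@le_lt_trans _ _ (sup (range T) - T N)); first by rewrite lerD2r.
  by rewrite ltrBlDr addrC -ltrBlDr.
move=> /cauchy_cvgP/cvg_ex[/= x Sx].
have near_x (e : R) : 0 < e ->
    exists N, forall n, (N <= n)%N -> rnorm (x - S n) < e.
  rewrite -(ltr_of_real k) of_real0 => oe0.
  move/cvg_ballP: Sx => /(_ _ oe0) [N _ SN]; exists N => n /SN /=.
  by rewrite -ball_normE/= -of_rnorm ltr_of_real.
exists x => [|m e e0].
  apply/ler_addgt0Pr => e e0; have [N /(_ N (leqnn _)) xN] := near_x _ e0.
  rewrite -(subrK (S N) x) addrC; apply: (le_trans (ler_rnormD _ _)).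
  apply: lerD; last exact: ltW.
  by apply: le_trans (TM N); exact: ler_rnorm_sum.
have [N xN] := near_x _ e0.
pose n := maxn N (pickle m).+1.
exists (s n); split; [exact: us| |by apply: xN; exact: leq_maxl].
rewrite mem_pmap; apply/mapP; exists (pickle m); last by rewrite pickleK_inv.
by rewrite mem_iota/= /n leq_maxr.
Qed.

(** * Complete families and interpolation *)

Section Interpolation.
Context (R : realType) (k : scalar_kind)
    (H : completeNormedModType (scalars R k)).
Context (ip : {dot H for @conjs R k}).
Hypothesis norm_ip : forall x : H, `|x| ^+ 2 = ip x x.
Context (I : countType).

(** If [y] in the span of [f] is within [e] of [h], then [<h, y> = 0] yields
    [|h|^2 = <h, h - y> <= |h| e], so that [|h| <= e]. *)
Lemma complete_ortho (f : I -> H) h :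
  complete_family f -> (forall i, ip h (f i) = 0) -> h = 0.
Proof.
move=> fc hf; apply/eqP; rewrite -rnorm_eq0 eq_le rnorm_ge0 andbT.
apply/ler_addgt0Pr => e e0; rewrite add0r.
have : closure (lin_span f [set: I]) h by rewrite fc.
have oe0 : 0 < of_real k e by rewrite -(of_real0 R k) ltr_of_real.
move=> /(_ (ball h (of_real k e))) []; first exact: nbhsx_ballx.
move=> _ [[s [a [_ ->]]]]; set y := \sum_(i <- s) _.
rewrite -ball_normE/= -of_rnorm => hy.
have hy0 : ip h y = 0.
  by rewrite ipsumr big1// => i _; rewrite ipZr hf mulr0.
have [->|h0] := eqVneq (rnorm h) 0; first exact: ltW.
rewrite -(@ler_pM2l _ (rnorm h)) ?lt_def ?h0 ?rnorm_ge0//.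
have -> : rnorm h * rnorm h = rnorm (ip h (h - y)).
  rewrite ipBr hy0 subr0 -norm_ip -(of_realK k (rnorm h * _)).
  by rewrite of_realM of_rnorm -expr2 /rnorm [in RHS]ger0_norm ?exprn_ge0.
apply: (le_trans (ler_rnorm_ip norm_ip _ _)); rewrite ler_wpM2l ?rnorm_ge0//.
by move: hy => /ltW; rewrite ler_of_real.
Qed.

(** Continuity of the inner product, specialized to the case in which a single
    term of the series survives. *)
Lemma absolutely_summable_ip (w : I -> H) (M : R) :
  (forall s : seq I, uniq s -> \sum_(i <- s) rnorm (w i) <= M) ->
  exists2 x, rnorm x <= M &
    forall m y, (forall i, i != m -> ip (w i) y = 0) -> ip x y = ip (w m) y.
Proof.
move=> /absolutely_summable[x xM xs]; exists x => // m y wy.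
apply/eqP; rewrite -subr_eq0 -rnorm_eq0 eq_le rnorm_ge0 andbT.
apply/ler_addgt0Pr => e e0; rewrite add0r.
(* The summand 1 keeps the divisor positive when [y = 0]. *)
have y1 : 0 < rnorm y + 1 by rewrite ltr_wpDl ?rnorm_ge0.
have [s [us ms xse]] := xs m _ (divr_gt0 e0 y1).
have -> : ip (w m) y = ip (\sum_(i <- s) w i) y.
  by rewrite ipsuml (bigD1_seq m)//= big1 ?addr0.
rewrite -ipBl; apply: (le_trans (ler_rnorm_ip norm_ip _ _)).
rewrite -[leRHS](divfK (lt0r_neq0 y1)).
by apply: ler_pM; rewrite ?rnorm_ge0 ?lerDl//; exact: ltW.
Qed.

(** The interpolant is [\sum_i a i q i]. The weight [t] stays free so that a
    single bound can later be optimized: its infimum over [t] is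
    [sqrt (A * B)], the Cauchy-Schwarz estimate of the series. *)
Lemma interpolation (g q : I -> H) (a : I -> scalars R k) (A B t : R) :
  biorthogonal ip g q ->
  (forall s, uniq s -> \sum_(i <- s) rnorm (a i) ^+ 2 <= A) ->
  (forall s, uniq s -> \sum_(i <- s) rnorm (q i) ^+ 2 <= B) ->
  0 < t ->
  exists2 x, rnorm x <= (t * A + t^-1 * B) / 2 & forall i, ip x (g i) = a i.
Proof.
move=> gq aA qB t0.
have [s us|x xM xg] := @absolutely_summable_ip (fun i => a i *: q i)
    ((t * A + t^-1 * B) / 2).
  have : \sum_(i <- s) (t * rnorm (a i) ^+ 2 + t^-1 * rnorm (q i) ^+ 2) / 2
      <= (t * A + t^-1 * B) / 2.
    rewrite -mulr_suml big_split -!mulr_sumr ler_pM2r ?invr_gt0//.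
    by apply: lerD; rewrite ler_pM2l ?invr_gt0//; [exact: aA|exact: qB].
  apply: le_trans; apply: ler_sum => i _; rewrite rnormZ.
  have := sqr_ge0 (t * rnorm (a i) - rnorm (q i)).
  rewrite -(pmulr_rge0 _ (x := t^-1)) ?invr_gt0//.
  have -> : t^-1 * (t * rnorm (a i) - rnorm (q i)) ^+ 2 = t * rnorm (a i) ^+ 2
     - 2 * (rnorm (a i) * rnorm (q i))
     + t^-1 * rnorm (q i) ^+ 2.
    by field; rewrite gt_eqF.
  lra.
have qg i j : ip (q i) (g j) = (j == i)%:R.
  by rewrite ipC gq conjs_nat.
exists x => // m; rewrite (xg m) ?ipZl ?qg ?eqxx ?mulr1// => i im.
by rewrite ipZl qg eq_sym (negPf im) mulr0.
Qed.

End Interpolation.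

(** * The theorem *)

Theorem theorem1p2 (R : realType) (k : scalar_kind)
    (H : completeNormedModType (scalars R k))
    (ip : {dot H for @conjs R k})
    (norm_ip : forall x : H, `|x| ^+ 2 = ip x x)
    (sepH : separable H)
    (I : countType) (f r : I -> H)
    (f_complete : complete_family f)
    (f_minimal : minimal_family f)
    (fr_biorthogonal : biorthogonal ip f r)
    (c : I -> R)
    (c_gt0 : forall n, 0 < c n)
    (sum_lty : (\esum_(n in [set: I]) (rnorm (r n) ^+ 2 / c n ^+ 2)%:E
                  < +oo)%E) :
  bessel_sequence ip (fun n => (of_real k (c n))^-1 *: r n) /\
  (complete_family (fun n => of_real k (c n) *: f n) /\
   riesz_fischer_sequence ip (fun n => of_real k (c n) *: f n)) /\
  lower_semi_frame ip (fun n => of_real k (c n) *: f n).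
Proof.
pose g n := of_real k (c n) *: f n; pose q n := (of_real k (c n))^-1 *: r n.
have oc0 n : of_real k (c n) != 0.
  by rewrite gt_eqF// -(of_real0 R k) ltr_of_real.
have gc : complete_family g.
  rewrite /complete_family -f_complete; congr closure.
  apply/seteqP; split => _ [s [a [_ ->]]].
    exists s, (fun i => a i * of_real k (c i)); split => //.
    by apply: eq_bigr => i _; rewrite scalerA.
  exists s, (fun i => a i / of_real k (c i)); split => //.
  by apply: eq_bigr => i _; rewrite scalerA divfK.
have gq : biorthogonal ip g q.
  move=> n m; rewrite ipZl ipZr -of_realV conjs_of_real fr_biorthogonal.
  have [<-|] := eqVneq n m; last by rewrite !mulr0.
  by rewrite mulr1 of_realV divff.
have rq n : rnorm (q n) ^+ 2 = rnorm (r n) ^+ 2 / c n ^+ 2.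
  rewrite rnormZ -of_realV rnorm_of_real ?invr_ge0 ?(ltW (c_gt0 n))//.
  by rewrite exprMn exprVn mulrC.
have [|B _ qB] := esum_lty_bound _ sum_lty.
  by move=> n; rewrite -rq exprn_ge0 ?rnorm_ge0.
have {}qB s : uniq s -> \sum_(i <- s) rnorm (q i) ^+ 2 <= B.
  by move=> /qB; under eq_bigr do rewrite -rq.
have B0 : 0 <= B by have := qB [::] isT; rewrite big_nil.
split.
  exists (B + 1); first by rewrite ltr_wpDl.
  move=> h; apply: esum_le => s us.
  apply: (@le_trans _ _ (\sum_(i <- s) rnorm (q i) ^+ 2 * rnorm h ^+ 2)).
    apply: ler_sum => i _; rewrite -exprMn mulrC.
    by rewrite ler_pXn2r ?nnegrE ?mulr_ge0 ?rnorm_ge0//; exact: ler_rnorm_ip.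
  rewrite -mulr_suml ler_wpM2r ?exprn_ge0 ?rnorm_ge0//.
  by rewrite (le_trans (qB s us))// lerDl.
split.
  split => // a /esum_lty_bound[|A _ aA].
    by move=> i; rewrite exprn_ge0 ?rnorm_ge0.
  have [x _ xg] := interpolation norm_ip gq aA qB ltr01.
  by exists x.
exists (B + 1)^-1; first by rewrite invr_gt0 ltr_wpDl.
move=> h.
have [->|] :=
  eqVneq (\esum_(i in [set: I]) (rnorm (ip h (g i)) ^+ 2)%:E)%E +oo%E.
  by rewrite leey.
rewrite -ltey => /esum_lty_bound[|A -> hA].
  by move=> i; rewrite exprn_ge0 ?rnorm_ge0.
have A0 : 0 <= A by have := hA [::] isT; rewrite big_nil.
have B1 : 0 < B + 1 by rewrite ltr_wpDl.
rewrite lee_fin mulrC ler_pdivrMr//.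
have [->|h0] := eqVneq (rnorm h) 0.
  by rewrite expr0n mulr_ge0// ltW.
have {}h0 : 0 < rnorm h by rewrite lt_def h0 rnorm_ge0.
have B1s s : uniq s -> \sum_(i <- s) rnorm (q i) ^+ 2 <= B + 1.
  by move=> us; rewrite (le_trans (qB s us))// lerDl.
(* [t = (B + 1) / |h|] balances the bound for its use below: the second term
   becomes [|h|]. *)
have [x xA xg] := interpolation norm_ip gq hA B1s (divr_gt0 B1 h0).
have xh : x = h.
  apply/eqP; rewrite -subr_eq0; apply/eqP.
  by apply: (complete_ortho norm_ip gc) => i; rewrite ipBl xg subrr.
move: xA; rewrite xh.
have -> : ((B + 1) / rnorm h * A + ((B + 1) / rnorm h)^-1 * (B + 1)) / 2
   = (A * (B + 1) / rnorm h + rnorm h) / 2.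
  by field; rewrite !gt_eqF.
rewrite ler_pdivlMr// mulr_natr mulr2n lerD2r ler_pdivlMr// -expr2.
Qed.
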